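(* Let $S:\mathbb{A}\to\mathbb{A}$ be a $C^2$ exact symplectic twist embedding that preserves the ends of the cylinder $\mathbb{A}$ and twists each end infinitely. Let $\Gamma$ be an invariant curve of $S$, let $\varphi$ be the associated homeomorphism of $\mathbb{R}$ and let $a,b:\mathbb{R}\to\mathbb{R}$ be the associated functions (all defined in the context). Consider four positive constants $B^\pm,C^\pm$ such that $$B^+\ge\max_{x\in\mathbb{R}}\frac{a(x)}{b(\varphi(x))},\qquad C^+\le\min_{x\in\mathbb{R}}\frac{b(x)}{b(\varphi(x))},$$ $$B^-\ge\max_{x\in\mathbb{R}}\frac{a(x)}{b(x)},\qquad C^-\le\min_{x\in\mathbb{R}}\frac{b(\varphi(x))}{b(x)}.$$ Suppose that $(B^+)^2-4C^+>0$ and $(B^-)^2-4C^->0$. Then, for every $x\in\mathbb{R}$, $$a(x)\ge b(\varphi(x))\,D^-+\frac{b(x)}{D^+},$$ where $$D^+=\frac12\left(B^++\sqrt{(B^+)^2-4C^+}\right),\qquad D^-=\frac{1}{2C^-}\left(B^--\sqrt{(B^-)^2-4C^-}\right).$$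
   Context: $\mathbb{T}=\mathbb{R}/\mathbb{Z}$, $\mathbb{A}=\mathbb{T}\times\mathbb{R}$. $S:\mathbb{A}\to\mathbb{A}$, $S(x,y)=(\bar x,\bar y)$, is a $C^2$-embedding; the same letters denote a lift to $\mathbb{R}^2$. Exact symplectic: there is a $C^2$ function $V:\mathbb{A}\to\mathbb{R}$ with $\bar y\,d\bar x-y\,dx=dV(x,y)$. Twist: $\partial\bar x/\partial y>0$ on $\mathbb{A}$. Preserves the ends: $\bar y\to\pm\infty$ as $y\to\pm\infty$ uniformly in $x$. Twists each end infinitely: $\bar x-x\to\pm\infty$ as $y\to\pm\infty$ uniformly in $x$. Generating function: for such $S$ there is a $C^2$ function $h:\mathbb{R}^2\to\mathbb{R}$ with $h(x+1,\bar x+1)=h(x,\bar x)$, $h_{12}<0$, and, for the lift, $S(x,y)=(\bar x,\bar y)$ if and only if $h_1(x,\bar x)=-y$ and $h_2(x,\bar x)=\bar y$. Subscripts of $h$ denote partial derivatives with respect to the corresponding variables. Invariant curve: a simple closed curve $\Gamma\subset\mathbb{A}$ homotopic to $\{(x,y)\in\mathbb{A}: y=k\}$ for some $k\in\mathbb{R}$, with $S(\Gamma)=\Gamma$. By Birkhoff's theorem $\Gamma=\{(x,P(x)):x\in\mathbb{T}\}$ for a Lipschitz function $P:\mathbb{T}\to\mathbb{R}$. The associated homeomorphism is $\varphi(x)=\pi_1\circ S(x,P(x))$ (computed with the lifts, $\pi_1$ the projection on the first coordinate); it is an increasing bi-Lipschitz homeomorphism of $\mathbb{R}$ with $\varphi(x+1)=\varphi(x)+1$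 and $h_2(\varphi^{-1}(x),x)+h_1(x,\varphi(x))=0$ for all $x$. The associated functions are $$a(x)=h_{22}(\varphi^{-1}(x),x)+h_{11}(x,\varphi(x)),\qquad b(x)=-h_{12}(\varphi^{-1}(x),x),$$ which are continuous and $1$-periodic, with $b>0$. *)

(* Defs.v *)
From HB Require Import structures.
From mathcomp Require Import all_boot all_order all_algebra.
From mathcomp Require Import generic_quotient.
From mathcomp Require Import all_classical all_reals all_analysis.

Set Implicit Arguments.
Unset Strict Implicit.
Unset Printing Implicit Defensive.

Import Order.TTheory GRing.Theory Num.Theory.
Import numFieldNormedType.Exports.

Local Open Scope classical_set_scope.
Local Open Scope ring_scope.
Local Open Scope quotient_scope.

Section circle.
Variable R : realType.

Definition circle_rel (x y : R) : bool := (x - y) \is a Num.int.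

Lemma circle_rel_refl : reflexive circle_rel.
Proof. by move=> x; rewrite /circle_rel subrr; exact: rpred0. Qed.

Lemma circle_rel_sym : symmetric circle_rel.
Proof. by move=> x y; rewrite /circle_rel -opprB rpredN. Qed.

Lemma circle_rel_trans : transitive circle_rel.
Proof.
by move=> y x z xy yz; rewrite /circle_rel -(subrK y x) -addrA rpredD.
Qed.

Canonical circle_equiv :=
  EquivRel circle_rel circle_rel_refl circle_rel_sym circle_rel_trans.

Definition circle : topologicalType :=
  quotient_topology {eq_quot circle_equiv}.

Definition to_circle (x : R) : circle :=
  \pi_(quotient_topology {eq_quot circle_equiv}) x.

Definition annulus : topologicalType := (circle * R)%type.

Definition to_annulus (p : R * R) : annulus := (to_circle p.1, p.2).

Lemma to_circleP (x y : R) :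
  to_circle x = to_circle y <-> (x - y) \is a Num.int.
Proof. by split=> [/eqmodP|xy]; [|apply/eqmodP]. Qed.

End circle.

Section calculus.
Variable R : realType.
Implicit Types (f : R * R -> R) (p : R * R).

Definition e1 : R * R := (1, 0).
Definition e2 : R * R := (0, 1).

Definition d1 f : R * R -> R := fun p => 'D_e1 f p.
Definition d2 f : R * R -> R := fun p => 'D_e2 f p.

Definition C1 f : Prop :=
  [/\ forall p, derivable f p e1 /\ derivable f p e2,
      continuous (d1 f) & continuous (d2 f)].

Definition C2 f : Prop := [/\ C1 f, C1 (d1 f) & C1 (d2 f)].

End calculus.

Section dynamics.
Variable R : realType.
Local Notation A := (annulus R).
Implicit Types (S : A -> A) (F : R * R -> R * R).

(* F (x + 1, y) = F (x, y) + (1, 0) is not imposed: the degree of the lift is an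
   integer, and it is forced to be 1 by the end conditions below. *)
Definition is_lift F S : Prop :=
  continuous F /\ forall p, to_annulus (F p) = S (to_annulus p).

(* F1 and F2 are the functions (x, y) |-> xbar and (x, y) |-> ybar. *)
Definition F1 F : R * R -> R := fun p => (F p).1.
Definition F2 F : R * R -> R := fun p => (F p).2.

(* Since R^2 -> A is a local diffeomorphism, being C^2 and being an immersion
   are read off the lift; injectivity and the homeomorphism onto the image are
   stated on the annulus itself. *)
Definition C2_embedding S F : Prop :=
  [/\ C2 (F1 F) /\ C2 (F2 F),
      forall p, d1 (F1 F) p * d2 (F2 F) p - d2 (F1 F) p * d1 (F2 F) p != 0,
      injective S, continuous S &
      forall U : set A, open U ->
        exists2 V : set A, open V & S @` U = V `&` range S].

(* ybar dxbar - y dx = dV, evaluated on every tangent vector v. *)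
Definition exact_symplectic F : Prop :=
  exists V : A -> R, C2 (V \o @to_annulus R) /\
    forall p v : R * R,
      F2 F p * 'D_v (F1 F) p - p.2 * v.1 = 'D_v (V \o @to_annulus R) p.

Definition twist F : Prop := forall p, 0 < d2 (F1 F) p.

(* g(x, y) -> +oo as y -> +oo and g(x, y) -> -oo as y -> -oo, both uniformly
   in x. *)
Definition uniformly_diverges (g : R * R -> R) : Prop :=
  (forall M : R, \forall y \near +oo_R, forall x, M < g (x, y)) /\
  (forall M : R, \forall y \near -oo_R, forall x, g (x, y) < M).

Definition preserves_ends F : Prop := uniformly_diverges (F2 F).

Definition twists_ends_infinitely F : Prop :=
  uniformly_diverges (fun p => F1 F p - p.1).

Definition generating_function F (h : R * R -> R) : Prop :=
  [/\ C2 h,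
      forall x xbar, h (x + 1, xbar + 1) = h (x, xbar),
      forall p, d2 (d1 h) p < 0 &
      forall x y xbar ybar,
        F (x, y) = (xbar, ybar) <->
        d1 h (x, xbar) = - y /\ d2 h (x, xbar) = ybar].

Definition loop_homotopic (c c' : circle R -> A) : Prop :=
  exists H : R * circle R -> A,
    [/\ {within `[0, 1] `*` setT, continuous H},
        forall t, H (0, t) = c t & forall t, H (1, t) = c' t].

(* The orientation of a parametrization c of the curve is free, so taking the
   horizontal circle with its standard orientation is no restriction. *)
Definition essential_simple_closed_curve (Gamma : set A) : Prop :=
  exists c : circle R -> A,
    [/\ continuous c, injective c, range c = Gamma &
        exists k : R, loop_homotopic c (fun t => (t, k))].

Definition invariant_curve S (Gamma : set A) : Prop :=
  essential_simple_closed_curve Gamma /\ S @` Gamma = Gamma.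

(* T carries its arc-length distance, so a function on T is Lipschitz exactly
   when the periodic function it induces on R is. *)
Definition lipschitz_graph (Gamma : set A) (P : circle R -> R) : Prop :=
  lipschitz (P \o @to_circle R) /\ Gamma = [set (x, P x) | x in setT].

Definition assoc_homeo F (P : circle R -> R) : R -> R :=
  fun x => F1 F (x, P (to_circle x)).

(* 'pinv_ is a total function; it is the inverse of phi because phi is a
   bijection. *)
Definition finv (phi : R -> R) : R -> R := 'pinv_(fun=> 0) setT phi.

Definition assoc_a (h : R * R -> R) (phi : R -> R) : R -> R :=
  fun x => d2 (d2 h) (finv phi x, x) + d1 (d1 h) (x, phi x).

Definition assoc_b (h : R * R -> R) (phi : R -> R) : R -> R :=
  fun x => - d2 (d1 h) (finv phi x, x).

End dynamics.

(* Main.v *)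
(**
Differentiating the functional equation h_2 (phi^-1 x, x) + h_1 (x, phi x) = 0
formally gives a = b * (phi^-1)' + (b o phi) * phi', so the inequality follows
from phi' <= D^+ and phi' >= D^-.  Differentiability of phi is not needed: for
each x the C^1 expansions of h_1 and h_2, together with b > 0 and the
monotonicity of phi, give for all e, w > 0
  (1 - e) (b(x) (psi y - psi x) + b(phi x) (phi y - phi x))
    <= (a(x) + e w) (y - x)    for y > x close to x, where psi = phi^-1.
If K is a Lipschitz constant of phi, then psi y - psi x >= (y - x) / K, and this
estimate shows that B^+ - C^+ / K is a local, hence a global, Lipschitz constant
as well.  The least constant M thus satisfies M <= B^+ - C^+ / M, so M <= D^+.
The same argument with phi and psi exchanged bounds the Lipschitz constant of
psi by 1 / D^-.
*)
Require Import Defs.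
From mathcomp Require Import all_boot all_order all_algebra.
From mathcomp Require Import all_classical all_reals all_analysis.
From mathcomp Require Import ring lra.

Import Order.TTheory GRing.Theory Num.Theory.
Import numFieldNormedType.Exports.

Local Open Scope classical_set_scope.
Local Open Scope ring_scope.

(** * Partial derivatives: mean values, first-order expansion, equality of mixed derivatives *)

Lemma C1_is_derive1 (R : realType) (f : R * R -> R) (x y : R) :
  C1 f -> is_derive x 1 (fun t => f (t, y)) (d1 f (x, y)).
Proof.
case=> /(_ (x, y))[+ _] _ _; rewrite /derivable => df.
have E : (fun k : R => k^-1 *: (((fun t => f (t, y)) \o shift x) (k *: 1) - f (x, y)))
       = (fun k : R => k^-1 *: ((f \o shift (x, y)) (k *: e1 R) - f (x, y))).
  apply/funext => k /=; congr (_ *: (f _ - _)).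
  by rewrite /e1; congr (_, _) => /=; rewrite ?scaler0 ?add0r.
by apply: DeriveDef; rewrite /derivable /d1 /derive E.
Qed.

Lemma C1_is_derive2 (R : realType) (f : R * R -> R) (x y : R) :
  C1 f -> is_derive y 1 (fun t => f (x, t)) (d2 f (x, y)).
Proof.
case=> /(_ (x, y))[_ +] _ _; rewrite /derivable => df.
have E : (fun k : R => k^-1 *: (((fun t => f (x, t)) \o shift y) (k *: 1) - f (x, y)))
       = (fun k : R => k^-1 *: ((f \o shift (x, y)) (k *: e2 R) - f (x, y))).
  apply/funext => k /=; congr (_ *: (f _ - _)).
  by rewrite /e2; congr (_, _) => /=; rewrite ?scaler0 ?add0r.
by apply: DeriveDef; rewrite /derivable /d2 /derive E.
Qed.

(** The intermediate point is located only by its distance to [a], so later uses need not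
    distinguish the sign of the increment. *)
Lemma mean_value (R : realType) (g g' : R -> R) (a b : R) :
  (forall t : R, is_derive t 1 g (g' t)) ->
  exists2 c, `|c - a| <= `|b - a| & g b - g a = g' c * (b - a).
Proof.
move=> dg.
have cg (u v : R) : {within `[u, v], continuous g}.
  by apply: derivable_within_continuous => t _; apply: ex_derive.
have [ab|/ltW ba] := leP a b.
  have [c] := MVT_segment ab (fun t _ => dg t) (cg a b).
  rewrite in_itv /= => /andP[ac cb] E; exists c => //.
  by rewrite !ger0_norm ?subr_ge0 // lerD2r.
have [c] := MVT_segment ba (fun t _ => dg t) (cg b a).
rewrite in_itv /= => /andP[bc ca] E; exists c.
  by rewrite (distrC c) (distrC b) !ger0_norm ?subr_ge0 // lerD2l lerN2.
by rewrite -opprB E -mulrN opprB.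
Qed.

Lemma mean_value_shift (R : realType) (g g' : R -> R) (a t : R) :
  (forall s : R, is_derive s 1 g (g' s)) ->
  exists2 c, `|c - a| <= `|t| & g (a + t) - g a = g' c * t.
Proof.
by move=> dg; have := mean_value _ _ _ a (a + t) dg; rewrite addrAC subrr add0r.
Qed.

Lemma nbhs_prod_ball (R : realType) (p : R * R) (Q : set (R * R)) :
  nbhs p Q -> exists2 e : R, 0 < e &
    forall q, `|q.1 - p.1| < e -> `|q.2 - p.2| < e -> Q q.
Proof.
move=> /nbhs_ballP[e /= e0 pQ]; exists e => // q q1 q2; apply: pQ.
by split; rewrite /= /ball /= distrC.
Qed.

Lemma continuous_near_dist (R : realType) (f : R * R -> R) (p : R * R) (e : R) :
  continuous f -> 0 < e -> \forall q \near p, `|f p - f q| < e.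
Proof. by move=> cf e0; move/cvgrPdist_lt: (cf p) => /(_ e e0). Qed.

(** The displacement is split at the corner [(p.1, q.2)]. The mean value theorem applies to each
    leg, and continuity of the partial derivatives at [p] makes both slope errors smaller than
    [e]. *)
Lemma C1_expansion (R : realType) (f : R * R -> R) (p : R * R) (e : R) :
  C1 f -> 0 < e ->
  exists2 r : R, 0 < r & forall q, `|q.1 - p.1| < r -> `|q.2 - p.2| < r ->
    `|f q - f p - (d1 f p * (q.1 - p.1) + d2 f p * (q.2 - p.2))|
      <= e * (`|q.1 - p.1| + `|q.2 - p.2|).
Proof.
move=> Cf e0; have [_ c1 c2] := Cf.
have /nbhs_prod_ball[r r0 near_p] :
    \forall q \near p, `|d1 f p - d1 f q| < e /\ `|d2 f p - d2 f q| < e.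
  by apply: filterI; exact: continuous_near_dist.
exists r => // -[x' y'] /=; case: p near_p => x y /= near_p.
move=> xr yr.
have [c cx E1] := mean_value _ _ _ x x' (fun t => C1_is_derive1 _ _ t y' Cf).
have [d dy E2] := mean_value _ _ _ y y' (fun t => C1_is_derive2 _ _ x t Cf).
have [h1 _] := near_p (c, y') (le_lt_trans cx xr) yr.
have [|_ h2] := near_p (x, d) _ (le_lt_trans dy yr); first by rewrite subrr normr0.
have -> : f (x', y') - f (x, y) - (d1 f (x, y) * (x' - x) + d2 f (x, y) * (y' - y))
  = - (d1 f (x, y) - d1 f (c, y')) * (x' - x) - (d2 f (x, y) - d2 f (x, d)) * (y' - y).
  by rewrite -(subrK (f (x, y')) (f (x', y'))) -addrA E1 -addrA; lra.
rewrite (le_trans (ler_normB _ _))// !normrM normrN mulrDr.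
by rewrite lerD// ler_wpM2r// ltW.
Qed.

Lemma dist_lt_halves (R : realType) (u v w e : R) :
  `|u - w| < e / 2 -> `|v - w| < e / 2 -> `|u - v| < e.
Proof.
move=> uw vw; rewrite (splitr e) (le_lt_trans (ler_distD w _ _))// ltrD//.
by rewrite distrC.
Qed.

(** Expanding [h_2] produces [h_21], whereas [assoc_b] is built from [h_12]. The second difference
    of [h] over a small square of side [t] is [t^2] times either mixed derivative at a nearby point,
    according to the order in which the mean value theorem is applied; continuity does the rest. *)
Lemma schwarz (R : realType) (h : R * R -> R) (p : R * R) :
  C2 h -> d1 (d2 h) p = d2 (d1 h) p.
Proof.
case=> C0 C1h C2h; have [_ _ c12] := C1h; have [_ c21 _] := C2h.
have square (x y t : R) : t != 0 -> exists c d c' d' : R,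
    [/\ `|c - x| <= `|t|, `|d - y| <= `|t|, `|c' - x| <= `|t|,
        `|d' - y| <= `|t| & d2 (d1 h) (c, d) = d1 (d2 h) (c', d')].
  move=> t0.
  pose g s := h (s, y + t) - h (s, y); pose k s := h (x + t, s) - h (x, s).
  have [|c cx gE] := mean_value_shift _ g
    (fun s => d1 h (s, y + t) - d1 h (s, y)) x t.
    by move=> s; apply: is_deriveB; exact: C1_is_derive1.
  have [|d dy d1hE] := mean_value_shift _ (fun s => d1 h (c, s))
    (fun s => d2 (d1 h) (c, s)) y t.
    by move=> s; exact: C1_is_derive2.
  have [|d' d'y kE] := mean_value_shift _ k
    (fun s => d2 h (x + t, s) - d2 h (x, s)) y t.
    by move=> s; apply: is_deriveB; exact: C1_is_derive2.
  have [|c' c'x d2hE] := mean_value_shift _ (fun s => d2 h (s, d'))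
    (fun s => d1 (d2 h) (s, d')) x t.
    by move=> s; exact: C1_is_derive1.
  exists c, d, c', d'; split; [exact: cx|exact: dy|exact: c'x|exact: d'y|].
  have gkE : g (x + t) - g x = k (y + t) - k y by rewrite /g /k; ring.
  apply: (mulIf t0); apply: (mulIf t0).
  have gE2 := etrans gE (congr1 (fun z => z * t) d1hE).
  have kE2 := etrans kE (congr1 (fun z => z * t) d2hE).
  exact: etrans (etrans (esym gE2) gkE) kE2.
apply/eqP/negPn/negP => neq.
have d0 : 0 < `|d1 (d2 h) p - d2 (d1 h) p| / 2 by rewrite divr_gt0 ?normr_gt0 ?subr_eq0.
set e := _ / 2 in d0.
have /nbhs_prod_ball[r r0 near_p] : \forall q \near p,
    `|d1 (d2 h) p - d1 (d2 h) q| < e /\ `|d2 (d1 h) p - d2 (d1 h) q| < e.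
  by apply: filterI; exact: continuous_near_dist.
have r2 : `|r / 2| < r by rewrite gtr0_norm; lra.
have /(square p.1 p.2)[c [d [c' [d' []]]]] : r / 2 != 0 by lra.
move=> /le_lt_trans/(_ r2) cr /le_lt_trans/(_ r2) dr.
move=> /le_lt_trans/(_ r2) c'r /le_lt_trans/(_ r2) d'r E.
have [_] := near_p (c, d) cr dr; rewrite E => near2.
have [near1 _] := near_p (c', d') c'r d'r.
by have := dist_lt_halves _ _ _ _ _ near1 near2; rewrite ltxx.
Qed.

(** * From right-sided local slopes to the optimal Lipschitz constant *)

(** Continuous induction: the set of points of [[x, y]] where the bound with slope [k + e] holds
    contains its supremum by continuity, and the local estimate to the right of the supremum rules
    out that it lies before [y]. *)
Lemma dini_le (R : realType) (f : R -> R) (k : R) :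
  continuous f ->
  (forall x e, 0 < e -> \forall y \near x^'+, f y - f x <= (k + e) * (y - x)) ->
  forall x y, x <= y -> f y - f x <= k * (y - x).
Proof.
move=> cf Df x y xy.
have [<-|x_y] := eqVneq x y; first by rewrite !subrr mulr0.
have {}xy : x < y by rewrite lt_neqAle x_y.
suff H (e : R) : 0 < e -> f y - f x <= (k + e) * (y - x).
  apply/ler_addgt0Pr => e e0.
  have := H (e / (y - x)); rewrite divr_gt0 ?subr_gt0// => /(_ isT).
  by rewrite mulrDl divfK ?subr_eq0 1?eq_sym// addrC.
move=> e0.
pose A := [set t | x <= t <= y /\ f t - f x <= (k + e) * (t - x)].
have Ax : A x by split; [rewrite lexx ltW|rewrite !subrr mulr0].
have supA : has_sup A.
  by split; [exists x|exists y => t [/andP[_]]].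
set s := sup A.
have xs : x <= s by apply: ub_le_sup => //; case: supA.
have sy : s <= y by apply: ge_sup; [exists x|move=> t [/andP[]]].
have As : A s.
  split; first by rewrite xs sy.
  rewrite leNgt; apply/negP => gts.
  pose g t := f t - f x - (k + e) * (t - x).
  have cg : continuous g.
    move=> t; apply: cvgB; first by apply: cvgB; [exact: cf|exact: cvg_cst].
    by apply: cvgM; [exact: cvg_cst|apply: cvgB]; [exact: cvg_id|exact: cvg_cst].
  have gs : 0 < g s by rewrite subr_gt0.
  have /nbhs_ballP[d /= d0 gpos] : nbhs s [set t | 0 < g t].
    exact: cvgr_gt (cg s) _ gs.
  have [t At] := sup_adherent d0 supA; rewrite -/s => st.
  have ts : t <= s by apply: ub_le_sup => //; case: supA.
  have : 0 < g t.
    by apply: gpos; rewrite /ball /= ger0_norm ?subr_ge0// ltrBlDr addrC -ltrBlDr.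
  by case: At => _; rewrite subr_gt0 leNgt => /negP.
have [->|s_y] := eqVneq y s; first by case: As.
have {}sy : s < y by rewrite lt_neqAle eq_sym s_y.
have : \forall t \near s^'+, [/\ s < t, t < y & f t - f s <= (k + e) * (t - s)].
  near=> t; split; near: t; [exact: nbhs_right_gt|exact: nbhs_right_lt|exact: Df].
move=> /filter_ex[t [st ty ft]].
have : A t.
  split; first by rewrite (ltW ty) (le_trans xs (ltW st)).
  case: As => _ fs; rewrite -(subrK (f s) (f t)) -addrA.
  by rewrite (le_trans (lerD ft fs))// -mulrDr addrA subrK.
by move=> /(ub_le_sup supA.2); rewrite -/s leNgt st.
Unshelve. all: by end_near.
Qed.

Lemma lipschitz_of_inverse_recursion (R : realType) (phi psi : R -> R) (B C : R) :
  0 < C ->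
  {homo phi : x y / x < y} -> cancel psi phi -> continuous phi ->
  (forall x e, 0 < e -> e < 1 -> \forall y \near x^'+,
     (1 - e) * (phi y - phi x + C * (psi y - psi x)) <= (B + e) * (y - x)) ->
  forall x y, x <= y ->
    phi y - phi x <= (B + Num.sqrt (B ^+ 2 - 4 * C)) / 2 * (y - x).
Proof.
move=> C0 phi_inc psiK phi_cont rec.
have psi_inc : {homo psi : x y / x < y}.
  move=> x y xy; rewrite ltNge; apply/negP => /(ltW_homo phi_inc).
  by rewrite !psiK leNgt xy.
pose valid := [set K | forall x y, x <= y -> phi y - phi x <= K * (y - x)].
(* A lower slope [c] of [psi] is inserted into the local estimate, and [dini_le] makes the resulting
   slope bound on [phi] global. *)
have improve c : (forall x y, x < y -> c * (y - x) <= psi y - psi x) ->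
    valid (B - C * c).
  move=> psi_c; apply: dini_le => // x e e0.
  (* With [eta = e / (1 + |B| + e)], the right side minus the left side is [eta * (|B| - B)], which
     is nonnegative for either sign of [B]. *)
  have [eta eta0 [eta1 eta_e]] :
      exists2 eta, 0 < eta & eta < 1 /\ B + eta <= (1 - eta) * (B + e).
    have d0 : 0 < 1 + `|B| + e by have := normr_ge0 B; lra.
    exists (e / (1 + `|B| + e)); first by rewrite divr_gt0.
    split; first by rewrite ltr_pdivrMr//; have := normr_ge0 B; lra.
    rewrite -subr_ge0 (_ : _ - _ = e / (1 + `|B| + e) * (`|B| - B)).
      by apply: mulr_ge0; rewrite ?subr_ge0 ?ler_norm// divr_ge0// ltW.
    by field; rewrite lt0r_neq0.
  near=> y.
  have xy : x < y by near: y; exact: nbhs_right_gt.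
  have : (1 - eta) * (phi y - phi x + C * (psi y - psi x)) <= (B + eta) * (y - x).
    by near: y; exact: rec.
  have := ler_wpM2r (ltW (x := 0) (y := y - x) _) eta_e; rewrite subr_gt0 => /(_ xy).
  move=> /[swap] /le_trans/[apply]; rewrite -mulrA ler_pM2l ?subr_gt0// => H.
  have := ler_wpM2l (ltW C0) (psi_c _ _ xy).
  by lra.
have valid_gt0 K : valid K -> 0 < K.
  move=> /(_ 0 1 ler01); rewrite subr0 mulr1; apply: lt_le_trans.
  by rewrite subr_gt0 phi_inc.
pose M := inf valid.
(* Monotonicity of [psi] gives the lower slope 0, which already makes [B] an admissible constant;
   this starts the recursion. *)
have inf_valid : has_inf valid.
  split; last by exists 0 => K /valid_gt0/ltW.
  exists (B - C * 0); apply: improve => x y xy.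
  by rewrite mul0r subr_ge0 ltW// psi_inc.
have valid_M : valid M.
  move=> x y; rewrite le_eqVlt => /predU1P[->|xy]; first by rewrite !subrr mulr0.
  rewrite -ler_pdivrMr ?subr_gt0//; apply: lb_le_inf => [|K vK]; first by case: inf_valid.
  by rewrite ler_pdivrMr ?subr_gt0//; apply: vK; exact: ltW.
have M0 := valid_gt0 _ valid_M.
(* The upper slope [M] of [phi] is the lower slope [1 / M] of [psi]; improving with it and using
   minimality of [M] closes the recursion. *)
have : M <= B - C * M^-1.
  apply: ge_inf; first by case: inf_valid.
  apply: improve => x y xy; rewrite mulrC ler_pdivrMr//.
  by have := valid_M _ _ (ltW (psi_inc _ _ xy)); rewrite !psiK mulrC.
rewrite lerBrDr -(ler_pM2r M0) mulrDl divfK ?lt0r_neq0// => M_quad.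
have M_le : M <= (B + Num.sqrt (B ^+ 2 - 4 * C)) / 2.
  (* Completing the square in [M^2 + C <= B M] gives [(2M - B)^2 <= B^2 - 4C]. *)
  have : 2 * M - B <= Num.sqrt (B ^+ 2 - 4 * C).
    rewrite (le_trans (ler_norm _))// -sqrtr_sqr ler_wsqrtr//; nra.
  by lra.
by move=> x y xy; rewrite (le_trans (valid_M _ _ xy))// ler_wpM2r// subr_ge0.
Unshelve. all: by end_near.
Qed.

(** * Lifts of circle maps of degree one *)

Lemma degree_one_int (R : realType) (phi : R -> R) (x : R) (m : int) :
  (forall x, phi (x + 1) = phi x + 1) -> phi (x + m%:~R) = phi x + m%:~R.
Proof.
move=> phi1.
have phiD (n : nat) y : phi (y + n%:R) = phi y + n%:R.
  by elim: n => [|n IHn]; rewrite ?addr0// -natr1 !addrA phi1 IHn.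
case: m => n; first exact: phiD.
by apply: (addIr n.+1%:R); rewrite NegzE rmorphN /= -phiD !subrK.
Qed.

Lemma degree_one_surj (R : realType) (phi : R -> R) (z : R) :
  continuous phi -> (forall x, phi (x + 1) = phi x + 1) ->
  exists x, phi x = z.
Proof.
move=> cphi phi1.
have phiD u n : phi (u + n%:R) = phi u + n%:R := degree_one_int _ phi u n phi1.
have phiB u n : phi (u - n%:R) = phi u - n%:R.
  by apply: (addIr n%:R); rewrite -phiD !subrK.
have /ltW := archi_boundP (normr_ge0 (z - phi 0)); set n := Num.bound _.
rewrite ler_norml => /andP[zn nz].
have nn : - n%:R <= n%:R :> R by rewrite -subr_ge0 opprK addr_ge0.
have phin : phi n%:R = phi 0 + n%:R by rewrite -phiD add0r.
have phiNn : phi (- n%:R) = phi 0 - n%:R. by rewrite -phiB add0r.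
have [|c _ <-] := IVT nn (continuous_subspaceT cphi) (v := z); last by exists c.
rewrite ge_min le_max phin phiNn; apply/andP; split; apply/orP; [left|right]; lra.
Qed.

(** If [phi y <= phi x] with [x < y], then for large [n] the value [phi y] lies between
    [phi (x - n) = phi x - n] and [phi x]. It is then also attained in [[x - n, x]], against
    injectivity. *)
Lemma degree_one_increasing (R : realType) (phi : R -> R) :
  continuous phi -> injective phi -> (forall x, phi (x + 1) = phi x + 1) ->
  {homo phi : x y / x < y}.
Proof.
move=> cphi phi_inj phi1 x y xy; rewrite ltNge; apply/negP => phi_yx.
have phiD u n : phi (u + n%:R) = phi u + n%:R := degree_one_int _ phi u n phi1.
have phiB u n : phi (u - n%:R) = phi u - n%:R.
  by apply: (addIr n%:R); rewrite -phiD !subrK.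
have /ltW := archi_boundP (normr_ge0 (phi x - phi y)); set n := Num.bound _.
rewrite ger0_norm ?subr_ge0// => le_n.
have xnx : x - n%:R <= x by rewrite gerBl.
have [|c] := IVT xnx (continuous_subspaceT cphi) (v := phi y).
  rewrite ge_min le_max phiB phi_yx orbT andbT; apply/orP; left; lra.
rewrite in_itv /= => /andP[_ cx] /phi_inj cy.
by move: cx; rewrite cy leNgt xy.
Qed.

Lemma increasing_inverse_continuous (R : realType) (phi psi : R -> R) :
  {homo phi : x y / x < y} -> {homo psi : x y / x < y} ->
  cancel phi psi -> cancel psi phi -> continuous psi.
Proof.
move=> phi_inc psi_inc phiK psiK x; apply/cvgrPdist_lt => e e0.
near=> y.
have lo : phi (psi x - e) < y.
  by near: y; apply: lt_nbhsr; rewrite -[ltRHS]psiK phi_inc// gtrBl.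
have hi : y < phi (psi x + e).
  by near: y; apply: lt_nbhsl; rewrite -[ltLHS]psiK phi_inc// ltrDl.
move: (psi_inc _ _ lo) (psi_inc _ _ hi); rewrite !phiK => *.
by rewrite ltr_norml; lra.
Unshelve. all: by end_near.
Qed.

(** * Periodicity of derivatives and continuity estimates *)

Lemma derive_periodic (R : realType) (h : R * R -> R) (v p q : R * R) :
  (forall p, h (p + q) = h p) -> 'D_v h (p + q) = 'D_v h p.
Proof.
move=> hq; rewrite /derive.
have -> : (fun k : R => k^-1 *: ((h \o shift (p + q)) (k *: v) - h (p + q)))
        = (fun k : R => k^-1 *: ((h \o shift p) (k *: v) - h p)).
  by apply/funext => k /=; rewrite addrA !hq.
by [].
Qed.

Lemma lipschitz_continuous (R : realType) (f : R -> R) :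
  lipschitz f -> continuous f.
Proof.
move=> /pinfty_ex_gt0[M M0 fM] x; apply/cvgrPdist_lt => e e0.
near=> y.
apply: le_lt_trans (fM (x, y) _) _ => //=.
by rewrite mulrC -ltr_pdivlMr//; near: y; apply: cvgr_dist_lt;
  [exact: cvg_id|exact: divr_gt0].
Unshelve. all: by end_near.
Qed.

Lemma continuous_near_right (R : realType) (f : R -> R) (x e : R) :
  continuous f -> 0 < e -> \forall y \near x^'+, `|f y - f x| < e.
Proof.
move=> cf e0; have /cvgrPdist_lt/(_ e e0) := cvg_at_right_filter (cf x).
by apply: filterS => y; rewrite distrC.
Qed.

(** * Linearization of the implicit equation without differentiating [phi] *)

(** Adding the two expansions cancels the values of [f] and [g]. The remaining error
    [eta * (u + v + 2 t)] is at most [e * (b u + c v + w t)], which explains the three bounds on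
    [eta]. *)
Lemma linear_error_bound (R : realType) (e w eta b c a1 a2 t u v f0 f1 g0 g1 : R) :
  eta <= e * b -> eta <= e * c -> eta <= e * w / 2 ->
  0 <= t -> 0 <= u -> 0 <= v -> f0 + g0 = 0 -> f1 + g1 = 0 ->
  `|f1 - f0 - (- b * u + a2 * t)| <= eta * (`|u| + `|t|) ->
  `|g1 - g0 - (a1 * t + - c * v)| <= eta * (`|t| + `|v|) ->
  (1 - e) * (b * u + c * v) <= (a2 + a1 + e * w) * t.
Proof.
move=> eb ec ew t0 u0 v0 fg0 fg1; rewrite (ger0_norm t0) (ger0_norm u0) (ger0_norm v0).
move=> fE gE; have := le_trans (ler_norm _) fE; have := le_trans (ler_norm _) gE.
have := ler_wpM2r u0 eb; have := ler_wpM2r v0 ec; have := ler_wpM2r t0 ew.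
lra.
Qed.

(** It is used with [f = h_2] and [g = h_1]. The increments of [phi] and [psi] are not known to be
    of order [y - x], so their errors are absorbed on the left by the factor [1 - e]; this relies on
    [b], [c] being positive and [phi], [psi] increasing. The free scale [w] is set to a coefficient
    or to 1 later. *)
Lemma implicit_linearization (R : realType) (f g : R * R -> R) (phi psi : R -> R)
    (x a1 a2 b c e w : R) :
  C1 f -> C1 g -> continuous phi -> continuous psi ->
  {homo phi : x y / x < y} -> {homo psi : x y / x < y} ->
  (forall x, f (psi x, x) + g (x, phi x) = 0) ->
  d1 f (psi x, x) = - b -> d2 f (psi x, x) = a2 ->
  d1 g (x, phi x) = a1 -> d2 g (x, phi x) = - c ->
  0 < b -> 0 < c -> 0 < e -> 0 < w ->
  \forall y \near x^'+,
    (1 - e) * (b * (psi y - psi x) + c * (phi y - phi x))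
      <= (a2 + a1 + e * w) * (y - x).
Proof.
move=> Cf Cg cphi cpsi phi_inc psi_inc eqn fb fa ga gc b0 c0 e0 w0.
pose eta := Num.min (e * b) (Num.min (e * c) (e * w / 2)).
have eta0 : 0 < eta by rewrite !lt_min !mulr_gt0//= divr_gt0// mulr_gt0.
have [eb ec ew] : [/\ eta <= e * b, eta <= e * c & eta <= e * w / 2].
  by rewrite !ge_min !lexx !orbT.
have [r1 r10 exp1] := C1_expansion _ _ (psi x, x) _ Cf eta0.
have [r2 r20 exp2] := C1_expansion _ _ (x, phi x) _ Cg eta0.
rewrite fb fa in exp1; rewrite ga gc in exp2.
have cid : continuous (fun y : R => y) by move=> ?; exact: cvg_id.
near=> y.
have xy : x < y by near: y; exact: nbhs_right_gt.
have yr1 : `|y - x| < r1 by near: y; exact: continuous_near_right cid _.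
have yr2 : `|y - x| < r2 by near: y; exact: continuous_near_right cid _.
have psir1 : `|psi y - psi x| < r1 by near: y; exact: continuous_near_right.
have phir2 : `|phi y - phi x| < r2 by near: y; exact: continuous_near_right.
apply: (linear_error_bound _ _ _ _ _ _ _ _ _ _ _ _ _ _ _ eb ec ew _ _ _ (eqn x) (eqn y)
         (exp1 (psi y, y) psir1 yr1) (exp2 (y, phi y) yr2 phir2)).
- by rewrite subr_ge0 ltW.
- by rewrite subr_ge0 ltW// psi_inc.
- by rewrite subr_ge0 ltW// phi_inc.
Unshelve. all: by end_near.
Qed.

(** * The dynamics along the invariant graph *)

(** This is where the lift is seen to have degree one: the derivatives of [h] inherit its diagonal
    period, and they determine [F]. *)
Lemma generating_function_shift (R : realType) (F : R * R -> R * R)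
    (h : R * R -> R) (x y : R) :
  generating_function F h -> F (x + 1, y) = (F1 F (x, y) + 1, F2 F (x, y)).
Proof.
case=> _ h_per _ FP; apply/FP.
have dh v xbar : 'D_v h (x + 1, xbar + 1) = 'D_v h (x, xbar).
  by apply: (derive_periodic _ h v (x, xbar) (1, 1)) => -[u u']; exact: h_per.
have /FP[h1 h2] : F (x, y) = (F1 F (x, y), F2 F (x, y)) by exact: surjective_pairing.
split.
  exact (etrans (dh (e1 R) (F1 F (x, y))) h1).
exact (etrans (dh (e2 R) (F1 F (x, y))) h2).
Qed.

(** Invariance is known only in the annulus, but [P] depends only on the class of the first
    coordinate, so it determines the second coordinate of the lifted image exactly. *)
Lemma invariant_graph_lift (R : realType) (S : annulus R -> annulus R)
    (F : R * R -> R * R) (Gamma : set (annulus R)) (P : circle R -> R) (x : R) :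
  is_lift F S -> S @` Gamma = Gamma -> Gamma = [set (x, P x) | x in setT] ->
  F (x, P (to_circle x))
    = (assoc_homeo F P x, P (to_circle (assoc_homeo F P x))).
Proof.
case=> _ FS SG GP.
have : Gamma (to_annulus (F (x, P (to_circle x)))).
  rewrite FS -SG; exists (to_annulus (x, P (to_circle x))) => //.
  by rewrite GP; exists (to_circle x).
rewrite GP => -[c _]; rewrite /to_annulus => -[cE PE].
by rewrite [LHS]surjective_pairing -PE cE.
Qed.

Lemma assoc_homeo_degree_one (R : realType) (F : R * R -> R * R)
    (h : R * R -> R) (P : circle R -> R) (x : R) :
  generating_function F h -> assoc_homeo F P (x + 1) = assoc_homeo F P x + 1.
Proof.
move=> gen; rewrite /assoc_homeo.
have -> : to_circle (x + 1) = to_circle x.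
  by apply/to_circleP; rewrite addrAC subrr add0r rpred1.
by rewrite [LHS]/F1 (generating_function_shift _ _ _ _ _ gen).
Qed.

(** * From the linearized inequality to the bound on [a] *)

(** Dividing by [c] gives the hypothesis of [lipschitz_of_inverse_recursion]; the error scale
    [w = c] leaves exactly [e] after the division. *)
Lemma normalize_linearization (R : realType) (a b c e t u v B C : R) :
  0 < c -> e < 1 -> 0 <= t -> 0 <= u -> a / c <= B -> C <= b / c ->
  (1 - e) * (b * u + c * v) <= (a + e * c) * t ->
  (1 - e) * (v + C * u) <= (B + e) * t.
Proof.
move=> c0 e1 t0 u0; rewrite ler_pdivrMr// ler_pdivlMr// => aB Cb lin.
rewrite -(ler_pM2l c0).
have H1 := ler_wpM2r t0 aB.
have e1' : 0 <= 1 - e by rewrite subr_ge0 ltW.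
have H2 := ler_wpM2l e1' (ler_wpM2r u0 Cb).
lra.
Qed.

Lemma le_of_perturbed (R : realType) (a X : R) :
  0 <= X -> (forall e, 0 < e -> e < 1 -> (1 - e) * X <= a + e) -> X <= a.
Proof.
move=> X0 H; apply/ler_addgt0Pr => eps eps0.
have d0 : 0 < 1 + X + eps by lra.
have e0 : 0 < eps / (1 + X + eps) by rewrite divr_gt0.
have e1 : eps / (1 + X + eps) < 1 by rewrite ltr_pdivrMr//; lra.
have := H _ e0 e1.
have : eps / (1 + X + eps) * (1 + X) <= eps.
  by rewrite mulrAC ler_pdivrMr// ler_wpM2l ?ltW//; lra.
lra.
Qed.

Lemma inverse_pair_bound (R : realType) (phi psi a b c : R -> R)
    (Bp Bm Cp Cm : R) (x : R) :
  0 < Bp -> 0 < Bm -> 0 < Cp -> 0 < Cm ->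
  {homo phi : x y / x < y} -> {homo psi : x y / x < y} ->
  cancel phi psi -> cancel psi phi -> continuous phi -> continuous psi ->
  (forall x, 0 < b x) -> (forall x, 0 < c x) ->
  (forall x e w, 0 < e -> 0 < w -> \forall y \near x^'+,
    (1 - e) * (b x * (psi y - psi x) + c x * (phi y - phi x))
      <= (a x + e * w) * (y - x)) ->
  (forall x, a x / c x <= Bp) -> (forall x, Cp <= b x / c x) ->
  (forall x, a x / b x <= Bm) -> (forall x, Cm <= c x / b x) ->
  0 < Bm ^+ 2 - 4 * Cm ->
  c x * (1 / (2 * Cm) * (Bm - Num.sqrt (Bm ^+ 2 - 4 * Cm)))
    + b x / (1 / 2 * (Bp + Num.sqrt (Bp ^+ 2 - 4 * Cp))) <= a x.
Proof.
move=> Bp0 Bm0 Cp0 Cm0 phi_inc psi_inc phiK psiK cphi cpsi b0 c0 lin.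
move=> aBp Cpb aBm Cmc disc.
have phi_lip := lipschitz_of_inverse_recursion _ phi psi Bp Cp Cp0 phi_inc psiK cphi.
have psi_lip := lipschitz_of_inverse_recursion _ psi phi Bm Cm Cm0 psi_inc phiK cpsi.
(* [Em] and [Dp] are the Lipschitz constants the recursion yields for [psi] and [phi]. *)
pose Em := (Bm + Num.sqrt (Bm ^+ 2 - 4 * Cm)) / 2.
pose Dp := (Bp + Num.sqrt (Bp ^+ 2 - 4 * Cp)) / 2.
have -> : 1 / 2 * (Bp + Num.sqrt (Bp ^+ 2 - 4 * Cp)) = Dp by rewrite mul1r mulrC.
have {}phi_lip : forall x y, x <= y -> phi y - phi x <= Dp * (y - x).
  apply: phi_lip => {}x e e0 e1; near=> y.
  have xy : x < y by near: y; exact: nbhs_right_gt.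
  apply: (normalize_linearization _ (a x) (b x) (c x)) => //.
  - by rewrite subr_ge0 ltW.
  - by rewrite subr_ge0 ltW// psi_inc.
  - by near: y; exact: lin.
(* The same argument with [phi] and [psi], and with [b] and [c], exchanged. *)
have {}psi_lip : forall x y, x <= y -> psi y - psi x <= Em * (y - x).
  apply: psi_lip => {}x e e0 e1; near=> y.
  have xy : x < y by near: y; exact: nbhs_right_gt.
  apply: (normalize_linearization _ (a x) (c x) (b x)) => //.
  - by rewrite subr_ge0 ltW.
  - by rewrite subr_ge0 ltW// phi_inc.
  - by rewrite (addrC (c x * _)); near: y; exact: lin.
have Dp0 : 0 < Dp by rewrite divr_gt0// ltr_wpDr// sqrtr_ge0.
have Em0 : 0 < Em by rewrite divr_gt0// ltr_wpDr// sqrtr_ge0.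
(* The two roots [(Bm - s) / 2] and [(Bm + s) / 2] have product [Cm], since positivity of the
   discriminant gives [s^2 = Bm^2 - 4 Cm]. *)
have -> : 1 / (2 * Cm) * (Bm - Num.sqrt (Bm ^+ 2 - 4 * Cm)) = Em^-1.
  apply: (mulIf (lt0r_neq0 Em0)); rewrite mulVf ?lt0r_neq0//.
  rewrite /Em; have := sqr_sqrtr (ltW disc); set s := Num.sqrt _ => sE.
  transitivity ((Bm ^+ 2 - s ^+ 2) / (4 * Cm)); first by field; rewrite lt0r_neq0.
  by rewrite sE; field; rewrite lt0r_neq0.
have X0 : 0 <= c x / Em + b x / Dp by rewrite addr_ge0// divr_ge0// ltW.
apply: le_of_perturbed => // e e0 e1.
have : \forall y \near x^'+, x < y /\
    (1 - e) * (b x * (psi y - psi x) + c x * (phi y - phi x))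
      <= (a x + e * 1) * (y - x).
  near=> y; split; near: y; [exact: nbhs_right_gt|exact: lin].
move=> /filter_ex[y [xy]]; rewrite mulr1 => lin_y.
have t0 : 0 < y - x by rewrite subr_gt0.
rewrite -(ler_pM2r t0); apply: le_trans lin_y.
(* Upper slopes become lower slopes of the inverse: the bound on [phi] between [psi x] and [psi y]
   controls the [b] term, and the bound on [psi] between [phi x] and [phi y] controls the [c]
   term. *)
rewrite -mulrA ler_pM2l ?subr_gt0// mulrDl addrC lerD//.
  rewrite -mulrA ler_pM2l// mulrC ler_pdivrMr// mulrC.
  by have := phi_lip _ _ (ltW (psi_inc _ _ xy)); rewrite !psiK.
rewrite -mulrA ler_pM2l// mulrC ler_pdivrMr// mulrC.
by have := psi_lip _ _ (ltW (phi_inc _ _ xy)); rewrite !phiK.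
Unshelve. all: by end_near.
Qed.

(** * Application to the invariant curve *)

Theorem theorem3p7 (R : realType)
    (S : annulus R -> annulus R) (F : R * R -> R * R)
    (lift_F : is_lift F S)
    (emb_S : C2_embedding S F)
    (exact_S : exact_symplectic F)
    (twist_S : twist F)
    (ends_S : preserves_ends F)
    (inf_twist_S : twists_ends_infinitely F)
    (h : R * R -> R) (gen_h : generating_function F h)
    (Gamma : set (annulus R)) (inv_Gamma : invariant_curve S Gamma)
    (P : circle R -> R) (graph_Gamma : lipschitz_graph Gamma P)
    (Bp Bm Cp Cm : R)
    (Bp_gt0 : 0 < Bp) (Bm_gt0 : 0 < Bm) (Cp_gt0 : 0 < Cp) (Cm_gt0 : 0 < Cm) :
  let phi := assoc_homeo F P in
  let a := assoc_a h phi in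
  let b := assoc_b h phi in
  (forall x, a x / b (phi x) <= Bp) ->
  (forall x, Cp <= b x / b (phi x)) ->
  (forall x, a x / b x <= Bm) ->
  (forall x, Cm <= b (phi x) / b x) ->
  0 < Bp ^+ 2 - 4 * Cp ->
  0 < Bm ^+ 2 - 4 * Cm ->
  let Dp := 1 / 2 * (Bp + Num.sqrt (Bp ^+ 2 - 4 * Cp)) in
  let Dm := 1 / (2 * Cm) * (Bm - Num.sqrt (Bm ^+ 2 - 4 * Cm)) in
  forall x, b (phi x) * Dm + b x / Dp <= a x.
Proof.
move=> phi a b aBp Cpb aBm Cmb disc_p disc_m Dp Dm x.
have [cF _] := lift_F; have [_ _ S_inj _ _] := emb_S.
have [_ SG] := inv_Gamma; have [lip_P GP] := graph_Gamma.
have [C2h _ h12_lt0 FP] := gen_h; have [_ C1h C2h2] := C2h.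
have F_graph y : F (y, P (to_circle y)) = (phi y, P (to_circle (phi y))).
  exact: invariant_graph_lift lift_F SG GP.
have phi1 y : phi (y + 1) = phi y + 1 := assoc_homeo_degree_one _ _ _ _ y gen_h.
have cphi : continuous phi.
  have cgraph : continuous (fun y => (y, P (to_circle y))).
    move=> y; exact: (cvg_pair cvg_id (lipschitz_continuous _ _ lip_P y)).
  move=> y; apply: (@cvg_comp _ _ _ _ fst _ (nbhs (F (y, P (to_circle y))))).
    exact: continuous_comp (cgraph y) (cF _).
  exact: cvg_fst.
(* Points of the graph with equal [phi] have the same image under [S], hence [y = z + m] with [m] an
   integer; degree one then forces [m = 0]. *)
have phi_inj : injective phi.
  move=> y z yz.
  have : S (to_annulus (y, P (to_circle y))) = S (to_annulus (z, P (to_circle z))).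
    by rewrite -!lift_F.2 !F_graph yz.
  move=> /S_inj[/to_circleP/intrP[m yzm] _].
  have yE : y = z + m%:~R by rewrite -yzm addrC subrK.
  move: yz; rewrite yE degree_one_int// => /eqP.
  by rewrite addrC -subr_eq0 addrK => /eqP ->; rewrite addr0.
have phi_inc := degree_one_increasing _ _ cphi phi_inj phi1.
pose psi := Defs.finv phi.
have phiK : cancel phi psi.
  by move=> y; apply: pinvKV; rewrite ?inE// => ? ? _ _; exact: phi_inj.
have psiK : cancel psi phi.
  move=> y; apply: pinvK; rewrite inE.
  by have [z <-] := degree_one_surj _ _ y cphi phi1; exists z.
have psi_inc : {homo psi : y z / y < z}.
  move=> y z yz; rewrite ltNge; apply/negP => /(ltW_homo phi_inc).
  by rewrite !psiK leNgt yz.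
have cpsi := increasing_inverse_continuous _ _ _ phi_inc psi_inc phiK psiK.
(* The height of the curve over [y] is read off twice, from the step leaving [y] and from the step
   arriving at [y]; comparing them gives the functional equation. *)
have h1E y : d1 h (y, phi y) = - P (to_circle y) by have /FP[] := F_graph y.
have h2E y : d2 h (psi y, y) = P (to_circle y).
  by have /FP[_] := F_graph (psi y); rewrite psiK.
have eqn y : d2 h (psi y, y) + d1 h (y, phi y) = 0 by rewrite h1E h2E subrr.
have b_gt0 y : 0 < b y by rewrite oppr_gt0; exact: h12_lt0.
have bphiE y : d2 (d1 h) (y, phi y) = - b (phi y).
  by rewrite /b /assoc_b opprK -/psi phiK.
have bE y : d1 (d2 h) (psi y, y) = - b y.
  exact (etrans (schwarz _ h (psi y, y) C2h) (esym (opprK _))).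
(* The pure second derivatives are passed by [erefl], so that their sum is [a y] by definition. *)
have lin y e w (e0 : 0 < e) (w0 : 0 < w) :=
  implicit_linearization _ (d2 h) (d1 h) phi psi y _ _ (b y) (b (phi y)) e w
    C2h2 C1h cphi cpsi phi_inc psi_inc eqn (bE y) erefl erefl (bphiE y)
    (b_gt0 y) (b_gt0 (phi y)) e0 w0.
exact (inverse_pair_bound _ phi psi a b (fun y => b (phi y)) Bp Bm Cp Cm x
  Bp_gt0 Bm_gt0 Cp_gt0 Cm_gt0 phi_inc psi_inc phiK psiK cphi cpsi
  b_gt0 (fun y => b_gt0 (phi y)) lin aBp Cpb aBm Cmb disc_m).
Qed.
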